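(* Let $V$ be a real topological vector space with topological dual $V^*$, let $u\in V$, let $\mathbb{Q}\subset V$ be a non-empty convex cone and let $K$ be a non-empty convex cone (in some real vector space). Let $h:K\to V$ be $\mathbb{Q}$-superlinear and let $k^*:K\to\mathbb{R}$ be sublinear. Assume that there exists a map $s:V\to K$ such that $h(s(v))-v\in\mathbb{Q}$ for all $v\in V$ and $k^*\circ s$ is bounded from above on some neighborhood of $0$ in $V$. Then $$\max_{v^*\in\Pi(k^*,h)}v^*(u)=\inf_{k\in\Phi(u,h)}k^*(k),$$ where the maximum is attained whenever the common value is not $-\infty$. Moreover, the equality is finite (rather than $-\infty=-\infty$) if and only if $k^*$ is $h$-positive.
   Context: A convex cone is a subset of a vector space closed under addition and under multiplication by non-negative scalars. A functional on a convex cone is sublinear if it is subadditive ($P(x+y)\le P(x)+P(y)$) and positively homogeneous ($P(\alpha x)=\alpha P(x)$ for $\alpha\ge 0$). A topological vector space is a vector space with a topology making addition and scalar multiplication continuous (neither Hausdorff nor locally convex is assumed). For $x,y\in V$ write $x\ge y$ iff $x-y\in\mathbb{Q}$. The map $h:K\to V$ is $\mathbb{Q}$-superlinear if $h(\lambda k)=\lambda h(k)$ for all $\lambda\ge 0$, $k\in K$, and $h(k+k')\ge h(k)+h(k')$ for all $k,k'\in K$. The functional $k^*$ is $h$-positive if $k^*(k)\ge 0$ for every $k\in K$ with $h(k)\in\mathbb{Q}$. $\Pi(k^*,h)$ is the set of $v^*\in V^*$ such that $v^*(q)\ge 0$ for all $q\in\mathbb{Q}$ and $v^*(h(k))\le k^*(k)$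 for all $k\in K$. For $v\in V$, $\Phi(v,h)=\{k\in K:\ h(k)\ge v\}$. The maximum over the empty set is $-\infty$. *)

(* Defs.v *)
From mathcomp Require Import all_boot all_order all_algebra.
From mathcomp Require Import all_classical all_reals all_analysis.

Set Implicit Arguments.
Unset Strict Implicit.
Unset Printing Implicit Defensive.

Import Order.TTheory GRing.Theory Num.Theory.
Import numFieldNormedType.Exports.

Local Open Scope classical_set_scope.
Local Open Scope ring_scope.

(* Maps defined on a cone K of E are represented by total functions on E, and
   every condition below constrains and uses their values on K only. *)

Definition convex_cone (R : realType) (E : lmodType R) (C : set E) : Prop :=
  (forall x y, C x -> C y -> C (x + y)) /\
  (forall (a : R) x, 0 <= a -> C x -> C (a *: x)).

Definition sublinear_on (R : realType) (E : lmodType R) (K : set E)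
    (p : E -> R) : Prop :=
  (forall x y, K x -> K y -> p (x + y) <= p x + p y) /\
  (forall (a : R) x, 0 <= a -> K x -> p (a *: x) = a * p x).

Definition cone_ge (R : realType) (V : lmodType R) (Q : set V) (x y : V) : Prop :=
  Q (x - y).

Definition superlinear_on (R : realType) (E V : lmodType R) (K : set E)
    (Q : set V) (h : E -> V) : Prop :=
  (forall (a : R) k, 0 <= a -> K k -> h (a *: k) = a *: h k) /\
  (forall k k', K k -> K k' -> cone_ge Q (h (k + k')) (h k + h k')).

Definition h_positive (R : realType) (E V : lmodType R) (K : set E)
    (Q : set V) (h : E -> V) (kstar : E -> R) : Prop :=
  forall k, K k -> Q (h k) -> 0 <= kstar k.

(* [topologicalLmodType] only requires continuity of the vector space
   operations: neither Hausdorff nor locally convex, unlike [tvsType]. *)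
Definition topological_dual (R : realType) (V : topologicalLmodType R) :
    set {scalar V} :=
  [set f : {scalar V} | continuous (f : V -> R)].

Definition Pi_set (R : realType) (E : lmodType R) (V : topologicalLmodType R)
    (K : set E) (Q : set V) (kstar : E -> R) (h : E -> V) : set {scalar V} :=
  [set f | [/\ topological_dual f,
               forall q, Q q -> 0 <= f q
             & forall k, K k -> f (h k) <= kstar k]].

Definition Phi_set (R : realType) (E V : lmodType R) (K : set E) (Q : set V)
    (v : V) (h : E -> V) : set E :=
  [set k | K k /\ cone_ge Q (h k) v].

(* Main.v *)
(* Set [p v := inf_{k in Phi(v,h)} k^*(k)].  If [k^*] is not [h]-positive, adding
   large multiples of a bad [k] shows that [p] is [-oo] and [Pi(k^*,h)] is empty.
   Otherwise [p v >= - k^*(s(-v))], so [p] is real-valued and sublinear, and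
   Hahn-Banach gives a linear [f <= p] with [f u = p u]; it belongs to
   [Pi(k^*,h)], being continuous because [p <= k^* o s] is bounded above near 0.
   Hahn-Banach is obtained without extending functionals from subspaces: by Zorn
   there is a minimal sublinear functional below a given one, and a minimal one
   is linear, since it coincides with its modifications [sublinear_along]. *)

From HB Require Import structures.
Require Import Defs.
From mathcomp Require Import all_boot all_order all_algebra.
From mathcomp Require Import all_classical all_reals all_analysis.
From mathcomp Require Import lra.

Set Implicit Arguments.
Unset Strict Implicit.
Unset Printing Implicit Defensive.

Import Order.TTheory GRing.Theory Num.Theory.
Import numFieldNormedType.Exports.

Local Open Scope classical_set_scope.
Local Open Scope ring_scope.

(** * Sublinear functionals and their infima *)

Lemma sublinear_onT_pos (R : realType) (V : lmodType R) (p : V -> R) :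
  (forall x y, p (x + y) <= p x + p y) ->
  (forall (a : R) x, 0 < a -> p (a *: x) <= a * p x) ->
  sublinear_on [set: V] p.
Proof.
move=> pD pZ; split=> [x y _ _|a x]; first exact: pD.
rewrite le_eqVlt => /predU1P[<- _|a0 _].
  (* The factors 2 and 1/2 at the origin give [p 0 <= 2 * p 0] and [p 0 <= p 0 / 2], hence
     [p 0 = 0]. *)
  have := pZ 2 0 (ltr0Sn R 1); have := pZ 2^-1 0; rewrite invr_gt0.
  by move=> /(_ (ltr0Sn R 1)); rewrite !scaler0 scale0r; lra.
apply/eqP; rewrite eq_le pZ //=.
have := pZ a^-1 (a *: x); rewrite invr_gt0 => /(_ a0).
by rewrite scalerA mulVf ?gt_eqF// scale1r ler_pdivlMl.
Qed.

(** Common source of sublinearity for three infima: over a half-line, over a chain of functionals,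
    and over [Phi_set]. Asking only for some [t <= r + s] is what suits chains, where [r] and [s]
    may come from different functionals. *)
Lemma inf_sublinear (R : realType) (V : lmodType R) (S : V -> set R) :
  (forall x, has_inf (S x)) ->
  (forall x y r s, S x r -> S y s -> exists2 t, S (x + y) t & t <= r + s) ->
  (forall (a : R) x r, 0 < a -> S x r -> exists2 t, S (a *: x) t & t <= a * r) ->
  sublinear_on [set: V] (fun x => inf (S x)).
Proof.
move=> Sinf SD SZ.
have le_inf x r : S x r -> inf (S x) <= r.
  by move=> Sxr; apply: ge_inf => //; exact: (Sinf x).2.
apply: sublinear_onT_pos => [x y|a x a0] /=.
  rewrite -lerBlDr; apply: lb_le_inf; first exact: (Sinf x).1.
  move=> r Sxr; rewrite lerBlDr -lerBlDl.
  apply: lb_le_inf; first exact: (Sinf y).1.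
  move=> s Sys; rewrite lerBlDl.
  by have [t St tle] := SD _ _ _ _ Sxr Sys; rewrite (le_trans _ tle)// le_inf.
rewrite -ler_pdivrMl//; apply: lb_le_inf; first exact: (Sinf x).1.
move=> r Sxr; rewrite ler_pdivrMl//.
by have [t St tle] := SZ _ _ _ a0 Sxr; rewrite (le_trans _ tle)// le_inf.
Qed.

Section sublinear.
Context (R : realType) (V : lmodType R) (p : V -> R).
Context (p_sublinear : sublinear_on [set: V] p).

Let pD x y : p (x + y) <= p x + p y. Proof. exact: p_sublinear.1. Qed.

Let pZ (a : R) x : 0 <= a -> p (a *: x) = a * p x.
Proof. by move=> a0; exact: p_sublinear.2. Qed.

Lemma sublinear0 : p 0 = 0.
Proof. by have := pZ 0 (lexx 0); rewrite scale0r mul0r. Qed.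

Lemma sublinearN x : - p (- x) <= p x.
Proof. by have := pD x (- x); rewrite subrr sublinear0; lra. Qed.

(** Additivity makes [p] odd, and oddness carries homogeneity over to negative scalars. *)
Lemma superadditive_linear :
  (forall x y, p x + p y <= p (x + y)) -> scalar p.
Proof.
move=> pDge; have {}pDE x y : p (x + y) = p x + p y.
  by apply/eqP; rewrite eq_le pD pDge.
have pN x : p (- x) = - p x.
  by have := pDE x (- x); rewrite subrr sublinear0; lra.
move=> a x y /=; rewrite pDE; congr (_ + _).
have [a0|/ltW a0] := leP 0 a; first exact: pZ.
by rewrite -[a]opprK scaleNr pN pZ ?oppr_ge0// -mulNr.
Qed.

(* The largest sublinear functional below [p] whose value at [- y] is at most
   [- p y]. *)
Definition sublinear_along (y x : V) : R :=
  inf [set p (x + t *: y) - t * p y | t in [set t | 0 <= t]].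

Let along_has_inf y x :
  has_inf [set p (x + t *: y) - t * p y | t in [set t | 0 <= t]].
Proof.
split; first by exists (p (x + 0 *: y) - 0 * p y), 0 => //=.
exists (- p (- x)) => _ [t /= t0 <-].
(* As [t *: y] is the sum of [- x] and [x + t *: y], [t * p y] is at most
   [p (- x) + p (x + t *: y)]. *)
have := pD (- x) (x + t *: y).
by rewrite addKr pZ//; lra.
Qed.

Lemma sublinear_along_le y x t :
  0 <= t -> sublinear_along y x <= p (x + t *: y) - t * p y.
Proof.
by move=> t0; apply: ge_inf; [exact: (along_has_inf y x).2|exists t].
Qed.

Lemma sublinear_along_le_id y x : sublinear_along y x <= p x.
Proof.
by have := sublinear_along_le y x (lexx 0); rewrite scale0r mul0r addr0 subr0.
Qed.

Lemma sublinear_along_sublinear y : sublinear_on [set: V] (sublinear_along y).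
Proof.
apply: inf_sublinear => [|x x' _ _ [t /= t0 <-] [t' /= t'0 <-]|
                         a x _ a0 [t /= t0 <-]].
- exact: along_has_inf.
- exists (p (x + x' + (t + t') *: y) - (t + t') * p y).
    by exists (t + t') => //=; rewrite addr_ge0.
  have := pD (x + t *: y) (x' + t' *: y).
  by rewrite addrACA -scalerDl; lra.
- exists (p (a *: x + (a * t) *: y) - (a * t) * p y).
    by exists (a * t) => //=; rewrite mulr_ge0// ltW.
  by rewrite -scalerA -scalerDr pZ ?(ltW a0)// mulrBr mulrA.
Qed.

End sublinear.

(** * Hahn-Banach through minimal sublinear functionals *)

Lemma minimal_sublinear_linear (R : realType) (V : lmodType R) (q : V -> R) :
  sublinear_on [set: V] q ->
  (forall r, sublinear_on [set: V] r -> (forall x, r x <= q x) ->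
     forall x, q x <= r x) ->
  scalar q.
Proof.
move=> qs qmin; apply: superadditive_linear => // x y.
(* Minimality gives [q x <= sublinear_along q y x], and the term [t = 1] of that infimum is
   [q (x + y) - q y]: [q] is superadditive. *)
have := qmin _ (sublinear_along_sublinear qs y) (sublinear_along_le_id qs y) x.
have := sublinear_along_le qs y x ler01.
by rewrite scale1r; lra.
Qed.

Lemma exists_minimal_sublinear (R : realType) (V : lmodType R) (p : V -> R) :
  sublinear_on [set: V] p ->
  exists q, [/\ sublinear_on [set: V] q, forall x, q x <= p x &
    forall r, sublinear_on [set: V] r -> (forall x, r x <= q x) ->
      forall x, q x <= r x].
Proof.
move=> ps.
pose P (q : V -> R) := sublinear_on [set: V] q /\ forall x, q x <= p x.
pose T := {q | P q}.
(* The order is reversed, so that a maximal element for Zorn's lemma is a minimal functional; chains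
   are bounded by their pointwise infimum. *)
pose ge (q r : T) := `[< forall x, sval r x <= sval q x >].
have pT : P p by split.
have [||A Atot|[q [qs qp]] qmin] := @ZL_preorder T (exist P p pT) ge.
- by move=> t; exact/asboolP.
- move=> r s t /asboolP rs /asboolP st; apply/asboolP => x.
  exact: le_trans (st x) (rs x).
- have [[g0 Ag0]|/set0P/negP/negPn/eqP ->] := pselect (A !=set0); last first.
    by exists (exist P p pT).
  pose S x := [set sval g x | g in A].
  have Sinf x : has_inf (S x).
    split; first by exists (sval g0 x), g0.
    exists (- p (- x)) => _ [[g [gs gp]] _ <-] /=.
    by rewrite (le_trans _ (sublinearN gs x))// lerN2.
  have le_inf g x : A g -> inf (S x) <= sval g x.
    by move=> Ag; apply: ge_inf; [exact: (Sinf x).2|exists g].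
  have infs : P (fun x => inf (S x)).
    split=> [|x]; last by rewrite (le_trans (le_inf g0 x Ag0))//; case: (svalP g0).
    apply: inf_sublinear => // [x y _ _ [g Ag <-] [g' Ag' <-]|
                               a x _ a0 [g Ag <-]].
      have [/asboolP gg'|/asboolP gg'] := Atot _ _ Ag Ag'.
        exists (sval g' (x + y)); first by exists g'.
        rewrite (le_trans ((svalP g').1.1 x y I I))//.
        by rewrite lerD2r.
      exists (sval g (x + y)); first by exists g.
      rewrite (le_trans ((svalP g).1.1 x y I I))//.
      by rewrite lerD2l.
    exists (sval g (a *: x)); first by exists g.
    by rewrite ((svalP g).1.2 a x (ltW a0) I).
  by exists (exist P _ infs) => g Ag; apply/asboolP => x; exact: le_inf.
- exists q; split=> // r rs rq.
  have rT : P r by split=> // x; exact: le_trans (rq x) (qp x).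
  have /(_ _)/asboolP := qmin (exist P r rT).
  by apply; exact/asboolP.
Qed.

(** Minimizing below [sublinear_along p u] instead of [p] forces [f (- u) <= - p u], which is the
    missing inequality [p u <= f u]. *)
Lemma sublinear_support (R : realType) (V : lmodType R) (p : V -> R) (u : V) :
  sublinear_on [set: V] p ->
  exists2 f : {scalar V}, (forall x, f x <= p x) & f u = p u.
Proof.
move=> ps.
have [q [qs qle qmin]] :=
  exists_minimal_sublinear (sublinear_along_sublinear ps u).
have ql := minimal_sublinear_linear qs qmin.
pose f : {scalar V} :=
  HB.pack q (GRing.isLinear.Build R V R *%R q ql).
have fp x : f x <= p x := le_trans (qle x) (sublinear_along_le_id ps u x).
exists f => //; apply/eqP; rewrite eq_le fp /=.
have : f (- u) <= - p u.
  rewrite (le_trans (qle _))//.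
  have := sublinear_along_le ps u (- u) ler01.
  by rewrite scale1r addNr sublinear0// mul1r sub0r.
by rewrite linearN lerN2.
Qed.

(** * Continuity from a one-sided bound *)

Lemma scalar_bounded_above_continuous (R : realType)
    (V : topologicalLmodType R) (f : {scalar V}) (U : set V) (M : R) :
  nbhs 0 U -> (forall x, U x -> f x <= M) -> continuous (f : V -> R).
Proof.
move=> U0 fM x; apply/cvgrPdist_lt => e e0.
(* The added 1 keeps the denominator positive and makes [c * M < e] strict, whatever the sign of
   [M]. *)
pose c := e / (`|M| + 1).
have M1 : 0 < `|M| + 1 by rewrite ltr_wpDl.
have c0 : 0 < c by rewrite divr_gt0.
have cvg0 (b : R) : (fun y => b *: (y - x)) @ x --> (0 : V).
  rewrite -[X in _ --> X](scaler0 _ b) -[X in _ *: X](subrr x).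
  apply: (@continuous_comp _ _ _ (fun y => (b, y - x) : R^o * V)
    (fun z => z.1 *: z.2)); last exact: scale_continuous.
  apply: (@cvg_pair _ _ _ _ (nbhs (b : R^o))); first exact: cvg_cst.
  apply: (@continuous_comp _ _ _ (fun y => (y, x)) (fun z : V * V => z.1 - z.2)).
    by apply: cvg_pair; [exact: cvg_id|exact: cvg_cst].
  exact: sub_continuous.
have cM : c * M < e.
  rewrite /c mulrAC ltr_pdivrMr// ltr_pM2l//.
  by have := ler_norm M; lra.
have scaleU b y : U (b *: (y - x)) -> b * (f y - f x) <= M.
  by move=> /fM; rewrite linearZ linearB.
near=> y.
(* Using both signs turns the upper bound on [U] into a bound on the absolute value of [f x - f y],
   without a symmetric neighborhood. *)
have U1 : U (c^-1 *: (y - x)) by near: y; exact: cvg0 U0.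
have U2 : U (- c^-1 *: (y - x)) by near: y; exact: cvg0 U0.
have := scaleU _ _ U1; rewrite ler_pdivrMl// => h1.
have := scaleU _ _ U2; rewrite mulNr -mulrN ler_pdivrMl// => h2.
by rewrite ltr_norml; apply/andP; split; lra.
Unshelve. all: by end_near.
Qed.

(** * The value function of the minimization problem *)

Section value_function.
Context (R : realType) (E V : lmodType R) (Q : set V) (K : set E).
Context (h : E -> V) (kstar : E -> R).
Context (Q_cone : convex_cone Q) (K_cone : convex_cone K).
Context (h_superlinear : superlinear_on K Q h).
Context (kstar_sublinear : sublinear_on K kstar).

Lemma Phi_setD v v' k k' : Phi_set K Q v h k -> Phi_set K Q v' h k' ->
  Phi_set K Q (v + v') h (k + k').
Proof.
move=> [Kk Qk] [Kk' Qk']; split; first exact: K_cone.1.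
have := Q_cone.1 _ _ (h_superlinear.2 _ _ Kk Kk') (Q_cone.1 _ _ Qk Qk').
by rewrite /cone_ge [X in _ + X]addrACA -opprD subrKA.
Qed.

Lemma Phi_setZ a v k : 0 <= a -> Phi_set K Q v h k ->
  Phi_set K Q (a *: v) h (a *: k).
Proof.
move=> a0 [Kk Qk]; split; first exact: K_cone.2.
by rewrite /cone_ge h_superlinear.1// -scalerBr; exact: Q_cone.2.
Qed.

(** Weak duality: [f] is monotone for the order of [Q], so [f v <= f (h k)]. *)
Lemma Phi_set_le (f : {scalar V}) v k :
  (forall q, Q q -> 0 <= f q) -> (forall k, K k -> f (h k) <= kstar k) ->
  Phi_set K Q v h k -> f v <= kstar k.
Proof.
move=> fQ fK [Kk /fQ]; rewrite linearB subr_ge0 => /le_trans; apply.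
exact: fK.
Qed.

Lemma not_h_positive_inf v : Phi_set K Q v h !=set0 ->
  ~ h_positive K Q h kstar ->
  ereal_inf [set (kstar k)%:E | k in Phi_set K Q v h] = -oo%E.
Proof.
move=> [k Phik] /existsNP[k0] /not_implyP[Kk0] /not_implyP[Qk0].
move=> /negP; rewrite -ltNge => k00.
have Phik0 : Phi_set K Q 0 h k0 by split; rewrite // /cone_ge subr0.
set S := (X in ereal_inf X).
have Phi_inf k' : Phi_set K Q v h k' -> (ereal_inf S <= (kstar k')%:E)%E.
  by move=> Phik'; apply: ereal_inf_lbound; exists k'.
case infE : (ereal_inf S) Phi_inf => [r||//] Phi_inf; last first.
  by have := Phi_inf _ Phik.
have := Phi_inf _ Phik; rewrite lee_fin => rk.
(* Chosen so that [kstar k + t * kstar k0 = r - 1], below the supposed infimum [r]. *)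
pose t := (kstar k - r + 1) / - kstar k0.
have t0 : 0 <= t by rewrite divr_ge0//; lra.
have tk0 : t * kstar k0 = - (kstar k - r + 1).
  by rewrite /t invrN mulrN mulNr divfK// lt_eqF.
have := Phi_setD Phik (Phi_setZ t0 Phik0).
rewrite scaler0 addr0 => /Phi_inf; rewrite lee_fin.
have := kstar_sublinear.1 _ _ Phik.1 (K_cone.2 _ _ t0 Kk0).
by rewrite kstar_sublinear.2// tk0 => *; exfalso; lra.
Qed.

Context (Phi_neq0 : forall v, Phi_set K Q v h !=set0).

(** A real infimum takes a default value on sets that are empty or unbounded below;
    [Phi_value_has_inf] excludes both cases. *)
Definition Phi_value (v : V) : R := inf (kstar @` Phi_set K Q v h).

Context (h_pos : h_positive K Q h kstar).

Lemma Phi_value_has_inf v : has_inf (kstar @` Phi_set K Q v h).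
Proof.
have [k Phik] := Phi_neq0 v; split; first by exists (kstar k), k.
have [k' Phik'] := Phi_neq0 (- v).
exists (- kstar k') => _ [{Phik}k Phik <-].
(* The sum [k + k'] is feasible for [v - v = 0], so [h]-positivity gives [0 <= kstar (k + k')]. *)
have [Kkk' Qkk'] := Phi_setD Phik Phik'.
move: Qkk'; rewrite subrr /cone_ge subr0 => /(h_pos Kkk').
by have := kstar_sublinear.1 _ _ Phik.1 Phik'.1; lra.
Qed.

Lemma Phi_value_le v k : Phi_set K Q v h k -> Phi_value v <= kstar k.
Proof.
by move=> Phik; apply: ge_inf; [exact: (Phi_value_has_inf v).2|exists k].
Qed.

Lemma Phi_value_sublinear : sublinear_on [set: V] Phi_value.
Proof.
apply: inf_sublinear => [|x y _ _ [k kx <-] [k' ky <-]|a x _ a0 [k kx <-]].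
- exact: Phi_value_has_inf.
- exists (kstar (k + k')); first by exists (k + k') => //; exact: Phi_setD.
  exact: kstar_sublinear.1 kx.1 ky.1.
- exists (kstar (a *: k)); first by exists (a *: k) => //; exact: Phi_setZ (ltW a0) kx.
  by rewrite (kstar_sublinear.2 _ _ (ltW a0) kx.1).
Qed.

End value_function.

Theorem theorem2p9 (R : realType) (V : topologicalLmodType R) (E : lmodType R)
    (u : V) (Q : set V) (K : set E) (h : E -> V) (kstar : E -> R)
    (Q_neq0 : Q !=set0) (Q_cone : convex_cone Q)
    (K_neq0 : K !=set0) (K_cone : convex_cone K)
    (h_superlinear : superlinear_on K Q h)
    (kstar_sublinear : sublinear_on K kstar)
    (s_exists : exists s : V -> E,
      [/\ forall v, K (s v),
          forall v, Q (h (s v) - v)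
        & exists2 U : set V, nbhs 0 U & has_ubound ((kstar \o s) @` U)]) :
  let maxPi := ereal_sup [set (f u)%:E | f in Pi_set K Q kstar h] in
  let infPhi := ereal_inf [set (kstar k)%:E | k in Phi_set K Q u h] in
  [/\ maxPi = infPhi,
      infPhi <> -oo%E ->
        exists2 f, Pi_set K Q kstar h f & (f u)%:E = maxPi
    & infPhi \is a fin_num <-> h_positive K Q h kstar].
Proof.
move=> maxPi infPhi.
have [s [Ks Qs [U U0 [M sM]]]] := s_exists.
have Phis v : Phi_set K Q v h (s v) by split; [exact: Ks|exact: Qs].
have Phi_neq0 v : Phi_set K Q v h !=set0 by exists (s v).
have Q0 : Q 0 by have [q Qq] := Q_neq0; rewrite -(scale0r q); exact: Q_cone.2.
have [h_pos|h_npos] := pselect (h_positive K Q h kstar); last first.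
  have infE : infPhi = -oo%E by exact: not_h_positive_inf.
  split; rewrite ?infE//.
  (* Any [f] in [Pi_set] would force [h]-positivity through [0 <= f (h k) <= kstar k]. *)
  apply/eqP; rewrite -leeNy_eq; apply: ge_ereal_sup => _ [f [_ fQ fK] <-].
  case: h_npos => k Kk Qk.
  exact: le_trans (fQ _ Qk) (fK _ Kk).
pose p := Phi_value Q K h kstar.
have p_le v k : Phi_set K Q v h k -> p v <= kstar k by exact: Phi_value_le.
have infE : infPhi = (p u)%:E.
  rewrite /infPhi -image_comp ereal_inf_EFin//.
    exact: (Phi_value_has_inf _ _ _ _ _ _ u).2.
  exact: (Phi_value_has_inf _ _ _ _ _ _ u).1.
have [f fp fu] : exists2 f : {scalar V}, (forall x, f x <= p x) & f u = p u.
  by apply: sublinear_support; exact: Phi_value_sublinear.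
have Pif : Pi_set K Q kstar h f.
  split.
  - apply: (scalar_bounded_above_continuous U0 (M := M)) => x Ux.
    rewrite (le_trans (fp x))// (le_trans (p_le _ _ (Phis x)))//.
    by apply: sM; exists x.
  - move=> q Qq; rewrite -oppr_le0 -linearN (le_trans (fp _))//.
    (* The origin, written [0 *: k] so that homogeneity on [K] applies, is feasible for [- q] at
       cost 0; hence [f (- q) <= 0]. *)
    have [k Kk] := K_neq0.
    have -> : 0 = kstar (0 *: k) by rewrite kstar_sublinear.2// mul0r.
    apply: p_le; split; first exact: K_cone.2.
    by rewrite /cone_ge h_superlinear.1// scale0r opprK add0r.
  (* Each [k] is feasible for its own image [h k], since [Q] contains 0. *)
  - move=> k Kk; rewrite (le_trans (fp _))//; apply: p_le; split=> //.
    by rewrite /cone_ge subrr.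
have maxE : maxPi = infPhi.
  apply/eqP; rewrite eq_le; apply/andP; split.
    apply: ge_ereal_sup => _ [g [_ gQ gK] <-].
    apply: le_ereal_inf_tmp => _ [k Phik <-].
    by rewrite lee_fin; exact: Phi_set_le Phik.
  by rewrite infE -fu; apply: ereal_sup_ubound; exists f.
split=> // [_|]; last by rewrite infE.
by exists f; rewrite // maxE infE fu.
Qed.
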